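(* Let $a,b,h\in\mathbb{R}$ with $b\ne 0$ and $h>0$, and consider the input-delay system $\dot x(t)=a\,x(t)+b\,u(t-h)$ with state feedback $u(t)=k\,x(t)$, so that the closed-loop system is $\dot x(t)=a\,x(t)+bk\,x(t-h)$. Let $S\in\mathbb{C}$ be a desired location for the rightmost eigenvalue of the closed-loop system. If $(S-a)h$ belongs to the upper boundary $W_0(BC)$ of the range of $W_0$, or to the real interval $[-1,\infty)$, then a real feedback gain $k$ assigning the rightmost eigenvalue to $S$ is obtained through $$k=\frac{S-a}{b}\,e^{Sh}.$$
   Context: For real $\alpha,\beta$ and $h>0$, the eigenvalues of the system $\dot x(t)=\alpha x(t)+\beta x(t-h)$ are the roots $s\in\mathbb{C}$ of $s-\alpha=\beta e^{-sh}$. In terms of the branches $W_k$, $k\in\mathbb{Z}$, of the Lambert W function (satisfying $W_k(z)e^{W_k(z)}=z$), they are $s_k=\alpha+\frac1h W_k(\beta h e^{-\alpha h})$. The rightmost eigenvalue is $s_0=\alpha+\frac1h W_0(\beta h e^{-\alpha h})$, where $W_0$ is the principal branch; it has the largest real part among all eigenvalues. For the closed-loop system in the claim, $\alpha=a$ and $\beta=bk$. $BC=(-\infty,-1/e)$ is the branch cut of $W_0$; on it the values of $W_0$ are taken with positive imaginary part, and $W_0(BC)$ is the upper boundary of the range of $W_0$ (the boundary between the ranges of $W_0$ and $W_1$), i.e. $W_0(BC)=\{-y\cot y+iy : 0<y<\pi\}$. *)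

(* Defs.v *)
(* Stdlib reals, with Coquelicot's complex numbers. *)
From Stdlib Require Export Reals ClassicalEpsilon.
From Coquelicot Require Export Coquelicot.

Open Scope R_scope.

Definition Cexp (z : C) : C :=
  (exp (Re z) * cos (Im z), exp (Re z) * sin (Im z)).

(* Only used at 0 < |y| < PI, where sin y <> 0. *)
Definition cot (y : R) : R := cos y / sin y.

(* Range of the principal branch: the region to the right of the curve
   x = - y cot y, -PI < y < PI (x = -1 at y = 0).  On the branch cut
   (-oo, -1/e) the values have positive imaginary part, so the part of the
   curve with y > 0 belongs to the range and the part with y < 0 does not. *)
Definition W0_range (w : C) : Prop :=
  (Im w = 0 /\ -1 <= Re w) \/
  (0 < Im w < PI /\ - Im w * cot (Im w) <= Re w) \/
  (- PI < Im w < 0 /\ - Im w * cot (Im w) < Re w).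

(* W_0 z is the solution w of w e^w = z in W0_range.  As w |-> w e^w is a
   bijection from W0_range onto C, this solution exists and is unique for
   every z, so the arbitrary value of epsilon never occurs. *)
Definition W0 (z : C) : C :=
  epsilon (inhabits (RtoC 0))
    (fun w : C => W0_range w /\ (w * Cexp w)%C = z).

Definition BC (z : C) : Prop :=
  exists r : R, r < - / exp 1 /\ z = RtoC r.

Definition W0_BC (w : C) : Prop :=
  exists z : C, BC z /\ w = W0 z.

(* Eigenvalues of x'(t) = alpha x(t) + beta x(t - h). *)
Definition eigenvalue (alpha beta h : R) (s : C) : Prop :=
  (s - RtoC alpha)%C = (RtoC beta * Cexp (- (s * RtoC h)))%C.

(* The eigenvalue s_0 given by the principal branch. *)
Definition eig0 (alpha beta h : R) : C :=
  (RtoC alpha + RtoC (/ h) * W0 (RtoC (beta * h * exp (- (alpha * h)))))%C.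

(* The maximum of the real parts may be attained at two conjugate
   eigenvalues; "the" rightmost eigenvalue is then s_0. *)
Definition rightmost_eigenvalue (alpha beta h : R) (s : C) : Prop :=
  s = eig0 alpha beta h /\
  eigenvalue alpha beta h s /\
  forall s' : C, eigenvalue alpha beta h s' -> Re s' <= Re s.

(* Main.v *)
Require Import Defs.
From Stdlib Require Import Lra Psatz.

(** With w = (s - alpha) h, the eigenvalues s correspond to the solutions w of
    w e^w = r, where r = beta h e^(- alpha h) is real ([eigenvalue_iff]).  The
    gain k is chosen so that w = (S - a) h is such a solution; it is real
    because w e^w is real both for w on the boundary curve and for real w.  So
    two facts about a real r are needed: W0 r is the only solution of
    w e^w = r in the principal range, and it has the largest real part among
    all solutions.

    In the strip 0 < Im w < PI, the product w e^w is real exactly on the curve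
    w = - y cot y + i y, where it equals - g(y) with
    g(y) = (y / sin y) e^(- y cot y) ([strip_solution]).  As y goes from 0 to
    PI, g increases strictly from 1/e to infinity ([curve_value_incr],
    [curve_value_gt], [curve_value_surj]).  On the real line,
    x e^x >= - 1/e, with strict monotonicity on [-1, oo).  Hence a solution in
    the principal range is real if r >= - 1/e and lies on the curve otherwise,
    and it is unique ([W0_range_solution_unique]).

    For the comparison of real parts, conjugation reduces to solutions v with
    Im v >= 0.  If 0 < Im v < PI, then v lies on the curve, hence in the
    principal range, so it is the principal solution.  If v is real, then
    r >= - 1/e and monotonicity of x e^x applies.  If Im v >= PI,
    comparing moduli suffices: |v|^2 e^(2 Re v) = |w|^2 e^(2 Re w) while
    (t^2 + 1/4) e^(2t) is nondecreasing in t, and Re v > Re w would then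
    contradict |Im v| > |Im w| and |Im v| > 1/2 ([same_modulus_Re_le]). *)

(** * The equation w e^w = r in real coordinates *)

Lemma Cexp_plus (z w : C) : Cexp (z + w)%C = (Cexp z * Cexp w)%C.
Proof.
  destruct z as [x y], w as [u v]; unfold Cexp, Cmult, Cplus, Re, Im; simpl.
  rewrite exp_plus, cos_plus, sin_plus; f_equal; ring.
Qed.

Lemma Cexp_RtoC (x : R) : Cexp (RtoC x) = RtoC (exp x).
Proof.
  unfold Cexp, RtoC, Re, Im; simpl; rewrite cos_0, sin_0; f_equal; ring.
Qed.

Lemma Cexp_opp_l (z : C) : (Cexp (- z) * Cexp z)%C = RtoC 1.
Proof.
  rewrite <- Cexp_plus.
  replace (- z + z)%C with (RtoC 0) by ring.
  now rewrite Cexp_RtoC, exp_0.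
Qed.

Lemma mul_Cexp_real (w : C) (r : R) :
  (w * Cexp w)%C = RtoC r <->
  exp (Re w) * (Re w * cos (Im w) - Im w * sin (Im w)) = r /\
  Re w * sin (Im w) + Im w * cos (Im w) = 0.
Proof.
  destruct w as [x y]; unfold Cexp, Cmult, RtoC, Re, Im; simpl.
  pose proof (exp_pos x) as He.
  split.
  - intros H; injection H as H1 H2; split; [lra|].
    apply (Rmult_eq_reg_l (exp x)); lra.
  - intros [H1 H2]; f_equal; [lra|].
    transitivity (exp x * (x * sin y + y * cos y)); [ring|].
    rewrite H2; ring.
Qed.

Lemma Re_Cconj (w : C) : Re (Cconj w) = Re w.
Proof. reflexivity. Qed.

Lemma Im_Cconj (w : C) : Im (Cconj w) = - Im w.
Proof. reflexivity. Qed.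

(** Because r is real, conjugation permutes the solutions; this reduces
    statements about real parts to the closed upper half-plane. *)
Lemma mul_Cexp_real_conj (w : C) (r : R) :
  (w * Cexp w)%C = RtoC r -> (Cconj w * Cexp (Cconj w))%C = RtoC r.
Proof.
  rewrite !mul_Cexp_real, Re_Cconj, Im_Cconj, cos_neg, sin_neg.
  intros [H1 H2]; split; [rewrite <- H1; ring | lra].
Qed.

Lemma mul_Cexp_real_norm (w : C) (r : R) :
  (w * Cexp w)%C = RtoC r ->
  ((Re w) ^ 2 + (Im w) ^ 2) * exp (2 * Re w) = r ^ 2.
Proof.
  rewrite mul_Cexp_real; destruct w as [x y]; unfold Re, Im; simpl fst; simpl snd.
  intros [H1 H2].
  replace (2 * x) with (x + x) by ring; rewrite exp_plus.
  pose proof (sin2_cos2 y) as H; unfold Rsqr in H.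
  assert (E : x ^ 2 + y ^ 2 =
    (x * cos y - y * sin y) ^ 2 + (x * sin y + y * cos y) ^ 2).
  { transitivity ((x ^ 2 + y ^ 2) * (sin y * sin y + cos y * cos y));
      [rewrite H|]; ring. }
  rewrite E, H2, <- H1; ring.
Qed.

(** This is 1 + t <= e^t at t = - 1 - x. *)
Lemma mul_exp_ge (x : R) : - / exp 1 <= x * exp x.
Proof.
  rewrite <- exp_Ropp.
  assert (H := exp_ineq1_le (- 1 - x)).
  replace (exp (- (1))) with (exp (- 1 - x) * exp x)
    by (rewrite <- exp_plus; f_equal; ring).
  pose proof (exp_pos x); nra.
Qed.

Lemma mul_exp_incr (x y : R) : -1 <= x -> x < y -> x * exp x < y * exp y.
Proof.
  intros Hx Hxy.
  destruct (MVT_cor2 (fun t => t * exp t) (fun t => (1 + t) * exp t) x y Hxy)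
    as [c [Hc1 Hc2]].
  - intros c _; apply is_derive_Reals; auto_derive; trivial; ring.
  - pose proof (exp_pos c).
    assert (0 < (1 + c) * exp c * (y - x)) by (repeat apply Rmult_lt_0_compat; lra).
    lra.
Qed.

(** * The boundary curve of the principal range *)

(** The number -r for the solution w = - y cot y + i y of w e^w = r. *)
Definition curve_value (y : R) : R := y / sin y * exp (- y * cot y).

(** Since sin (Im w) <> 0 in this strip, the vanishing of the imaginary part
    x sin y + y cos y (up to the factor e^x) determines x = - y cot y. *)
Lemma strip_solution (w : C) (r : R) :
  0 < Im w < PI ->
  (w * Cexp w)%C = RtoC r <->
  Re w = - Im w * cot (Im w) /\ r = - curve_value (Im w).
Proof.
  intros Hy; rewrite mul_Cexp_real; unfold curve_value, cot.
  destruct w as [x y]; unfold Re, Im in *; simpl fst in *; simpl snd in *.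
  assert (Hs : 0 < sin y) by (apply sin_gt_0; lra).
  pose proof (sin2_cos2 y) as H; unfold Rsqr in H.
  assert (Hv : forall e, e * (- y * (cos y / sin y) * cos y - y * sin y)
                         = - (y / sin y * e)).
  { intros e.
    transitivity (- (y / sin y * e) * (sin y * sin y + cos y * cos y));
      [field; lra | rewrite H; ring]. }
  split.
  - intros [H1 H2].
    assert (Hx : x = - y * (cos y / sin y)).
    { apply (Rmult_eq_reg_r (sin y)); [|lra].
      field_simplify; [lra | lra]. }
    split; [exact Hx|].
    rewrite <- H1, Hx; apply Hv.
  - intros [Hx Hr]; rewrite Hx, Hr; split; [apply Hv | field; lra].
Qed.

(** The difference sin t - t cos t vanishes at 0 and has derivative t sin t. *)
Lemma cos_mul_lt_sin (y : R) : 0 < y < PI -> y * cos y < sin y.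
Proof.
  intros Hy.
  destruct (MVT_cor2 (fun t => sin t - t * cos t) (fun t => t * sin t) 0 y)
    as [c [Hc1 Hc2]]; [lra | |].
  - intros c _; apply is_derive_Reals; auto_derive; trivial; ring.
  - assert (0 < sin c) by (apply sin_gt_0; lra).
    rewrite sin_0, Rmult_0_l in Hc1.
    assert (0 < c * sin c * (y - 0)) by (repeat apply Rmult_lt_0_compat; lra).
    lra.
Qed.

(** Both factors exceed their limits 1 and 1/e at 0, because sin y < y and
    y cos y < sin y. *)
Lemma curve_value_gt (y : R) : 0 < y < PI -> / exp 1 < curve_value y.
Proof.
  intros Hy; unfold curve_value, cot.
  assert (Hs : 0 < sin y) by (apply sin_gt_0; lra).
  assert (Hl := sin_lt_x y ltac:(lra)).
  assert (Hc := cos_mul_lt_sin y Hy).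
  assert (H1 : 1 < y / sin y).
  { apply Rmult_lt_reg_r with (sin y); trivial; field_simplify; lra. }
  assert (H2 : exp (- (1)) < exp (- y * (cos y / sin y))).
  { apply exp_increasing.
    apply Rmult_lt_reg_r with (sin y); trivial.
    field_simplify; lra. }
  rewrite <- exp_Ropp.
  pose proof (exp_pos (- (1))); nra.
Qed.

(** Written as a positive factor times a sum of squares, to show its sign. *)
Lemma is_derive_curve_value (y : R) : 0 < y < PI ->
  is_derive curve_value y
    (exp (- y * cot y) / sin y * ((1 - y * cot y) ^ 2 + y ^ 2)).
Proof.
  intros Hy.
  assert (Hs : 0 < sin y) by (apply sin_gt_0; lra).
  unfold curve_value, cot.
  auto_derive; [lra|].
  unfold Rdiv; field; lra.
Qed.

Lemma curve_value_continuous (y : R) : 0 < y < PI -> continuity_pt curve_value y.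
Proof.
  intros Hy; apply continuity_pt_filterlim.
  apply (ex_derive_continuous curve_value).
  eexists; now apply is_derive_curve_value.
Qed.

Lemma curve_value_incr (y1 y2 : R) :
  0 < y1 -> y1 < y2 -> y2 < PI -> curve_value y1 < curve_value y2.
Proof.
  intros H1 H12 H2.
  eapply (incr_function curve_value 0 PI); simpl; try lra.
  - intros y Ha Hb; apply is_derive_curve_value; simpl in *; lra.
  - intros y Ha Hb; simpl in *.
    assert (0 < sin y) by (apply sin_gt_0; lra).
    apply Rmult_lt_0_compat.
    + apply Rdiv_lt_0_compat; trivial; apply exp_pos.
    + pose proof (pow2_ge_0 (1 - y * cot y)); nra.
Qed.

Lemma curve_value_inj (y1 y2 : R) : 0 < y1 < PI -> 0 < y2 < PI ->
  curve_value y1 = curve_value y2 -> y1 = y2.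
Proof.
  intros H1 H2 E.
  destruct (Rtotal_order y1 y2) as [L | [L | L]]; trivial; exfalso.
  - pose proof (curve_value_incr y1 y2); lra.
  - pose proof (curve_value_incr y2 y1); lra.
Qed.

(** The expression is singular at 0 only in appearance: it depends on y through
    cos y and sin y / y. *)
Lemma is_lim_curve_value_0 : is_lim curve_value 0 (/ exp 1).
Proof.
  apply is_lim_ext_loc with
    (fun y => exp (- cos y * / (sin y / y)) * / (sin y / y)).
  - exists (mkposreal PI PI_RGT_0); intros y Hb Hy0.
    unfold ball in Hb; simpl in Hb; unfold AbsRing_ball, abs, minus, plus, opp in Hb;
      simpl in Hb.
    apply Rabs_def2 in Hb.
    assert (Hs : sin y <> 0).
    { destruct (Rtotal_order y 0) as [L | [L | L]]; [| lra |].
      - assert (0 < sin (- y)) by (apply sin_gt_0; lra).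
        rewrite sin_neg in *; lra.
      - assert (0 < sin y) by (apply sin_gt_0; lra); lra. }
    unfold curve_value, cot.
    replace (- y * (cos y / sin y)) with (- cos y * / (sin y / y))
      by (field; split; trivial).
    field; split; trivial.
  - assert (Hsinc : is_lim (fun y => / (sin y / y)) 0 1).
    { replace (Finite 1) with (Rbar_inv 1) by (simpl; f_equal; field).
      apply is_lim_inv; [apply is_lim_sinc_0 | injection; lra]. }
    assert (Hcos : is_lim (fun y => - cos y) 0 (-1)).
    { replace (Finite (-1)) with (Finite (- cos 0)) by (rewrite cos_0; f_equal; ring).
      apply (is_lim_continuity (fun y => - cos y) 0).
      apply continuity_pt_opp, continuity_cos. }
    assert (Harg : is_lim (fun y => - cos y * / (sin y / y)) 0 (- (1))).
    { replace (Finite (- (1))) with (Rbar_mult (-1) 1) by (simpl; f_equal; ring).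
      apply is_lim_mult; [exact Hcos | exact Hsinc | exact I]. }
    replace (Finite (/ exp 1)) with (Rbar_mult (/ exp 1) 1) by (simpl; f_equal; ring).
    apply is_lim_mult; [| exact Hsinc | exact I].
    rewrite <- exp_Ropp.
    apply (is_lim_comp_continuous _ exp _ (- (1)) Harg).
    apply continuity_pt_filterlim, derivable_continuous_pt, derivable_pt_exp.
Qed.

(** Past PI / 2 the cotangent is nonpositive, so the factor y / sin y alone
    makes the value large near PI. *)
Lemma curve_value_unbounded (M : R) : exists y, 0 < y < PI /\ M < curve_value y.
Proof.
  pose proof PI_RGT_0 as HPI; pose proof PI2_1 as HPI2.
  set (N := Rmax M 1).
  assert (HM : M <= N) by apply Rmax_l.
  assert (HN : 1 <= N) by apply Rmax_r.
  (* sin (PI - e) < e, hence y / sin y > 1 / e = N for y = PI - e >= 1 *)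
  set (e := / N).
  assert (He : 0 < e <= 1).
  { unfold e; split; [apply Rinv_0_lt_compat; lra|].
    rewrite <- Rinv_1; apply Rinv_le_contravar; lra. }
  exists (PI - e); split; [lra|].
  unfold curve_value, cot.
  assert (Hs : sin (PI - e) = sin e) by (rewrite sin_minus, sin_PI, cos_PI; ring).
  assert (Hc : cos (PI - e) = - cos e).
  { rewrite cos_minus, cos_PI, sin_PI; ring. }
  rewrite Hs, Hc.
  assert (Hs0 : 0 < sin e) by (apply sin_gt_0; lra).
  assert (Hs1 := sin_lt_x e ltac:(lra)).
  assert (Hc0 : 0 < cos e) by (apply cos_gt_0; lra).
  assert (Ha : N < (PI - e) / sin e).
  { assert (EN : N * e = 1) by (unfold e; field; lra).
    apply Rmult_lt_reg_r with (sin e); trivial.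
    replace ((PI - e) / sin e * sin e) with (PI - e) by (field; lra).
    nra. }
  assert (Hb : 1 < exp (- (PI - e) * (- cos e / sin e))).
  { rewrite <- exp_0.
    apply exp_increasing.
    replace (- (PI - e) * (- cos e / sin e)) with ((PI - e) * (cos e / sin e))
      by (field; lra).
    apply Rmult_lt_0_compat; [lra | now apply Rdiv_lt_0_compat]. }
  nra.
Qed.

Lemma curve_value_surj (M : R) :
  / exp 1 < M -> exists y, 0 < y < PI /\ curve_value y = M.
Proof.
  intros HM.
  destruct (curve_value_unbounded M) as [y2 [Hy2 HM2]].
  destruct (IVT_Rbar_incr curve_value 0 y2 (/ exp 1) (curve_value y2) M)
    as [y Hy]; simpl; try lra; trivial.
  - apply is_lim_curve_value_0.
  - apply is_lim_continuity, curve_value_continuous; lra.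
  - intros y Ha Hb; simpl in *; apply curve_value_continuous; lra.
  - simpl in Hy; exists y; split; lra.
Qed.

(** * The principal branch at real arguments *)

(** A nonreal solution with |Im w| < PI lies on the curve or on its mirror
    image, and only the upper one belongs to the range. *)
Lemma W0_range_solution_cases (w : C) (r : R) :
  W0_range w -> (w * Cexp w)%C = RtoC r ->
  (Im w = 0 /\ -1 <= Re w /\ r = Re w * exp (Re w)) \/
  (0 < Im w < PI /\ Re w = - Im w * cot (Im w) /\ r = - curve_value (Im w)).
Proof.
  intros [[H1 H2] | [[H1 H2] | [H1 H2]]] E.
  - left; split; [|split]; trivial.
    apply mul_Cexp_real in E; rewrite H1, cos_0, sin_0 in E.
    destruct E as [E _]; rewrite <- E; ring.
  - right; split; trivial; now apply strip_solution.
  - (* the conjugate lies on the curve, but the lower half of the curve is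
       excluded from the range *)
    exfalso.
    apply mul_Cexp_real_conj in E.
    apply strip_solution in E; rewrite ?Im_Cconj, ?Re_Cconj in *; [|lra].
    destruct E as [E _].
    unfold cot in *; rewrite cos_neg, sin_neg in E.
    assert (Hs : 0 < sin (- Im w)) by (apply sin_gt_0; lra).
    rewrite sin_neg in Hs.
    replace (- - Im w * (cos (Im w) / - sin (Im w)))
      with (- Im w * (cos (Im w) / sin (Im w))) in E by (field; lra).
    lra.
Qed.

(** Real solutions have r >= - 1/e and solutions on the curve r < - 1/e, so the
    two kinds do not mix; within each kind, r is a strictly monotone function of
    the coordinate. *)
Lemma W0_range_solution_unique (w1 w2 : C) (r : R) :
  W0_range w1 -> W0_range w2 ->
  (w1 * Cexp w1)%C = RtoC r -> (w2 * Cexp w2)%C = RtoC r -> w1 = w2.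
Proof.
  intros R1 R2 E1 E2.
  pose proof (W0_range_solution_cases w1 r R1 E1) as C1.
  pose proof (W0_range_solution_cases w2 r R2 E2) as C2.
  destruct w1 as [x1 y1], w2 as [x2 y2]; unfold Re, Im in *;
    simpl fst in *; simpl snd in *.
  destruct C1 as [[A1 [B1 D1]] | [A1 [B1 D1]]];
    destruct C2 as [[A2 [B2 D2]] | [A2 [B2 D2]]].
  - f_equal; [|lra].
    destruct (Rtotal_order x1 x2) as [L | [L | L]]; trivial; exfalso.
    + pose proof (mul_exp_incr x1 x2); lra.
    + pose proof (mul_exp_incr x2 x1); lra.
  - exfalso; pose proof (mul_exp_ge x1); pose proof (curve_value_gt y2 A2); lra.
  - exfalso; pose proof (mul_exp_ge x2); pose proof (curve_value_gt y1 A1); lra.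
  - assert (y1 = y2) by (apply curve_value_inj; lra).
    subst y2; f_equal; lra.
Qed.

Lemma W0_eq (w : C) (r : R) :
  W0_range w -> (w * Cexp w)%C = RtoC r -> W0 (RtoC r) = w.
Proof.
  intros Hw E; unfold W0.
  destruct (epsilon_spec (inhabits (RtoC 0))
    (fun v : C => W0_range v /\ (v * Cexp v)%C = RtoC r)
    (ex_intro _ w (conj Hw E))) as [H1 H2].
  exact (W0_range_solution_unique _ _ r H1 Hw H2 E).
Qed.

(** The explicit point of the curve obtained from [curve_value_surj] is what
    shows that the choice defining W0 is not vacuous on the branch cut. *)
Lemma W0_range_of_W0_BC (w : C) :
  W0_BC w -> exists r, W0_range w /\ (w * Cexp w)%C = RtoC r.
Proof.
  intros [z [[r [Hr Hz]] Hw]]; exists r.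
  destruct (curve_value_surj (- r) ltac:(lra)) as [y [Hy Ey]].
  pose (v := (- y * cot y, y) : C).
  assert (Hv : W0_range v).
  { right; left; unfold v, Re, Im; simpl; split; [exact Hy | lra]. }
  assert (Ev : (v * Cexp v)%C = RtoC r).
  { apply strip_solution; unfold v, Re, Im; simpl; trivial; split; trivial; lra. }
  rewrite Hz, (W0_eq v r Hv Ev) in Hw; subst w; now split.
Qed.

(** The derivative is 2 (t + 1/2)^2 e^(2t); the constant 1/4 is the one that
    makes it a square. *)
Lemma sqr_add_quarter_mul_exp_le (s t : R) :
  s <= t -> (s ^ 2 + / 4) * exp (2 * s) <= (t ^ 2 + / 4) * exp (2 * t).
Proof.
  intros [Hst | ->]; [|lra].
  destruct (MVT_cor2 (fun t => (t ^ 2 + / 4) * exp (2 * t))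
    (fun t => 2 * (t + / 2) ^ 2 * exp (2 * t)) s t Hst) as [c [Hc1 Hc2]].
  - intros c _; apply is_derive_Reals; auto_derive; trivial; field.
  - pose proof (exp_pos (2 * c)); pose proof (pow2_ge_0 (c + / 2)).
    assert (0 <= 2 * (c + / 2) ^ 2 * exp (2 * c) * (t - s))
      by (apply Rmult_le_pos; [apply Rmult_le_pos|]; lra).
    lra.
Qed.

(** Here x + i y and u + i v give the same modulus of w e^w.  If x < u, then
    subtracting this equality from the monotonicity of (t^2 + 1/4) e^(2t) leaves
    (v^2 - 1/4) e^(2u) <= (y^2 - 1/4) e^(2x), which is impossible when
    v^2 > 1/4 and v^2 >= y^2. *)
Lemma same_modulus_Re_le (x y u v : R) :
  y ^ 2 <= v ^ 2 -> / 4 < v ^ 2 ->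
  (x ^ 2 + y ^ 2) * exp (2 * x) = (u ^ 2 + v ^ 2) * exp (2 * u) -> u <= x.
Proof.
  intros Hyv Hv E.
  destruct (Rle_or_lt u x) as [L | L]; trivial; exfalso.
  pose proof (sqr_add_quarter_mul_exp_le x u ltac:(lra)) as M.
  assert (Hexp : exp (2 * x) < exp (2 * u)) by (apply exp_increasing; lra).
  pose proof (exp_pos (2 * x)).
  assert (K : (v ^ 2 - / 4) * exp (2 * u) <= (y ^ 2 - / 4) * exp (2 * x)) by lra.
  assert ((v ^ 2 - / 4) * exp (2 * x) < (v ^ 2 - / 4) * exp (2 * u))
    by (apply Rmult_lt_compat_l; lra).
  assert ((y ^ 2 - / 4) * exp (2 * x) <= (v ^ 2 - / 4) * exp (2 * x))
    by (apply Rmult_le_compat_r; lra).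
  lra.
Qed.

(** Solutions in the strip |Im| < PI are compared through the classification,
    those outside it through their modulus. *)
Lemma W0_range_solution_rightmost (w w' : C) (r : R) :
  W0_range w -> (w * Cexp w)%C = RtoC r ->
  (w' * Cexp w')%C = RtoC r -> Re w' <= Re w.
Proof.
  intros Hw E E'.
  assert (Hup : forall v : C, 0 <= Im v -> (v * Cexp v)%C = RtoC r -> Re v <= Re w).
  { clear w' E'; intros v Hv Ev.
    pose proof (W0_range_solution_cases w r Hw E) as Cw.
    pose proof PI2_1 as HPI.
    destruct (Rle_or_lt PI (Im v)) as [HP | HP].
    - apply (same_modulus_Re_le _ (Im w) _ (Im v)).
      + assert (0 <= Im w <= Im v) by (destruct Cw as [[A _] | [A _]]; lra).
        nra.
      + nra.
      + now rewrite (mul_Cexp_real_norm w r E), (mul_Cexp_real_norm v r Ev).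
    - destruct Hv as [Hv | Hv].
      + assert (v = w) as ->; [|lra].
        apply (W0_range_solution_unique v w r); trivial.
        apply strip_solution in Ev; [|lra].
        right; left; split; lra.
      + apply mul_Cexp_real in Ev; rewrite <- Hv, cos_0, sin_0 in Ev.
        assert (Er : r = Re v * exp (Re v)) by lra.
        pose proof (mul_exp_ge (Re v)).
        destruct Cw as [[_ [B D]] | [A [_ D]]].
        * destruct (Rle_or_lt (Re v) (Re w)) as [L | L]; trivial.
          pose proof (mul_exp_incr _ _ B L); lra.
        * pose proof (curve_value_gt _ A); lra. }
  destruct (Rle_or_lt 0 (Im w')) as [L | L].
  - now apply Hup.
  - rewrite <- Re_Cconj; apply Hup.
    + rewrite Im_Cconj; lra.
    + now apply mul_Cexp_real_conj.
Qed.

(** * The feedback gain *)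

(** The substitution w = (s - alpha) h turns the characteristic equation into
    w e^w = beta h e^(- alpha h). *)
Lemma eigenvalue_iff (alpha beta h : R) (s : C) : 0 < h ->
  eigenvalue alpha beta h s <->
  ((s - RtoC alpha) * RtoC h * Cexp ((s - RtoC alpha) * RtoC h))%C
    = RtoC (beta * h * exp (- (alpha * h))).
Proof.
  intros Hh; unfold eigenvalue.
  assert (Hh' : RtoC h <> RtoC 0) by (intros E; injection E; lra).
  assert (Ew : Cexp ((s - RtoC alpha) * RtoC h)%C
             = (Cexp (s * RtoC h) * RtoC (exp (- (alpha * h))))%C).
  { rewrite <- Cexp_RtoC, <- Cexp_plus, RtoC_opp, RtoC_mult; f_equal; ring. }
  rewrite Ew, !RtoC_mult.
  pose proof (Cexp_opp_l (s * RtoC h)) as Einv.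
  assert (He : RtoC (exp (- (alpha * h))) <> RtoC 0).
  { intros E; injection E; pose proof (exp_pos (- (alpha * h))); lra. }
  set (P := Cexp (s * RtoC h)) in *.
  set (M := Cexp (- (s * RtoC h))) in *.
  set (e := RtoC (exp (- (alpha * h)))) in *.
  split; intros E.
  - rewrite E.
    transitivity (RtoC beta * RtoC h * e * (M * P))%C; [ring|].
    rewrite Einv; ring.
  - assert (E' : ((s - RtoC alpha) * P)%C = RtoC beta).
    { transitivity ((s - RtoC alpha) * RtoC h * (P * e) / (RtoC h * e))%C;
        [field; now split | rewrite E; field; now split]. }
    transitivity ((s - RtoC alpha) * (M * P))%C;
      [rewrite Einv; ring | rewrite <- E'; ring].
Qed.

(** Uniqueness in the range identifies (S - alpha) h with the value of W0, and
    multiplication by h > 0 preserves the order of real parts. *)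
Lemma rightmost_of_W0_range (alpha beta h : R) (S : C) : 0 < h ->
  W0_range ((S - RtoC alpha) * RtoC h)%C ->
  eigenvalue alpha beta h S -> rightmost_eigenvalue alpha beta h S.
Proof.
  intros Hh HR HS.
  assert (Hh' : RtoC h <> RtoC 0) by (intros E; injection E; lra).
  pose proof HS as E; apply eigenvalue_iff in E; trivial.
  split; [|split]; trivial.
  - unfold eig0; rewrite (W0_eq _ _ HR E), RtoC_inv by lra; field; trivial.
  - intros s' Hs'; apply eigenvalue_iff in Hs'; trivial.
    pose proof (W0_range_solution_rightmost _ _ _ HR E Hs') as L.
    destruct S as [x y], s' as [x' y']; unfold Re in *; simpl in *.
    apply (Rmult_le_reg_r h); lra.
Qed.

Theorem corollary3 (a b h : R) (S : C) (hb : b <> 0) (hh : 0 < h)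
    (hS : W0_BC ((S - RtoC a) * RtoC h)%C \/
          (exists x : R, -1 <= x /\ ((S - RtoC a) * RtoC h)%C = RtoC x)) :
  exists k : R,
    RtoC k = ((S - RtoC a) / RtoC b * Cexp (S * RtoC h))%C /\
    rightmost_eigenvalue a (b * k) h S.
Proof.
  assert (Hw : exists r, W0_range ((S - RtoC a) * RtoC h)%C /\
    ((S - RtoC a) * RtoC h * Cexp ((S - RtoC a) * RtoC h))%C = RtoC r).
  { destruct hS as [H | [x [Hx Ex]]]; [now apply W0_range_of_W0_BC|].
    exists (x * exp x); rewrite Ex; split.
    - left; unfold Re, Im; simpl; lra.
    - now rewrite Cexp_RtoC, RtoC_mult. }
  destruct Hw as [r [HR E]].
  assert (Hb : RtoC b <> RtoC 0) by (intros Eb; injection Eb; lra).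
  assert (Hh : RtoC h <> RtoC 0) by (intros Eh; injection Eh; lra).
  (* k solves b k h e^(- a h) = r *)
  set (k := r * exp (a * h) / (b * h)).
  assert (Hk : r = b * k * h * exp (- (a * h))).
  { unfold k.
    transitivity (r * (exp (a * h) * exp (- (a * h)))); [|field; lra].
    rewrite <- exp_plus, Rplus_opp_r, exp_0; ring. }
  rewrite Hk in E.
  apply eigenvalue_iff in E; trivial.
  exists k; split; [|now apply rightmost_of_W0_range].
  unfold eigenvalue in E; rewrite E, RtoC_mult.
  transitivity (RtoC k * (Cexp (- (S * RtoC h)) * Cexp (S * RtoC h)))%C.
  - rewrite Cexp_opp_l; ring.
  - field; trivial.
Qed.
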